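(* Let $a=1+a_2\mathbf j+a_3\mathbf k$ with $a_2,a_3\in\mathbb R$, $a_2^2+a_3^2=1$, let $b=b_1\mathbf i+b_2\mathbf j+b_3\mathbf k\ne0$ and $c\in\mathbb H_s$. Assume $P_{ab}=0$, $I_b\neq0$ and $I_b+2P_{ac}\ne0$. Then the equation $ax^2+bx+c=0$ is solvable in $\mathbb H_s$, and $$x=(Ta+b)^{-1}(aN-c),\quad\text{where}\quad N=\frac{I_c}{I_b+2P_{ac}},\qquad T=\frac{-2P_{bc}}{I_b+2P_{ac}}.$$
   Context: $\mathbb H_s$ is the split quaternion algebra: the 4-dimensional associative real algebra with basis $1,\mathbf i,\mathbf j,\mathbf k$ and $\mathbf i^2=-1$, $\mathbf j^2=\mathbf k^2=1$, $\mathbf i\mathbf j=\mathbf k=-\mathbf j\mathbf i$, $\mathbf j\mathbf k=-\mathbf i=-\mathbf k\mathbf j$, $\mathbf k\mathbf i=\mathbf j=-\mathbf i\mathbf k$. For $x=x_0+x_1\mathbf i+x_2\mathbf j+x_3\mathbf k$ and $y=y_0+y_1\mathbf i+y_2\mathbf j+y_3\mathbf k$ with real coefficients: $\bar x=x_0-x_1\mathbf i-x_2\mathbf j-x_3\mathbf k$, $P_{xy}=\langle x,y\rangle=x_0y_0+x_1y_1-x_2y_2-x_3y_3$, $I_x=\langle x,x\rangle=\bar xx$. An element $x$ is invertible iff $I_x\ne0$, and then $x^{-1}=\bar x/I_x$. *)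

(* Defs.v *)
From HB Require Import structures.
From mathcomp Require Import all_boot all_order all_algebra.
From mathcomp Require Import reals.
From mathcomp Require Import ring.

Set Implicit Arguments.
Unset Strict Implicit.
Unset Printing Implicit Defensive.

Import GRing.Theory.
Local Open Scope ring_scope.

(* SplitQuat x0 x1 x2 x3 stands for x0 + x1 i + x2 j + x3 k; see [splitquatE]. *)
Record splitquat (R : realType) : Type :=
  SplitQuat { qre : R; qi : R; qj : R; qk : R }.

Section SplitQuatAlgebra.
Variable R : realType.
Local Notation H := (splitquat R).
Implicit Types x y z : H.

Definition splitquat_code x := (qre x, qi x, qj x, qk x).
Definition splitquat_decode (t : R * R * R * R) : H :=
  let: (x0, x1, x2, x3) := t in SplitQuat x0 x1 x2 x3.
Lemma splitquat_codeK : cancel splitquat_code splitquat_decode.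
Proof. by case. Qed.

HB.instance Definition _ := Choice.copy H (can_type splitquat_codeK).

Definition qadd x y :=
  SplitQuat (qre x + qre y) (qi x + qi y) (qj x + qj y) (qk x + qk y).
Definition qzero : H := SplitQuat 0 0 0 0.
Definition qopp x := SplitQuat (- qre x) (- qi x) (- qj x) (- qk x).

Lemma qaddA : associative qadd.
Proof. by move=> x y z; rewrite /qadd /= !addrA. Qed.
Lemma qaddC : commutative qadd.
Proof. by move=> x y; congr SplitQuat; rewrite addrC. Qed.
Lemma qadd0 : left_id qzero qadd.
Proof. by case=> *; rewrite /qadd /= !add0r. Qed.
Lemma qaddN : left_inverse qzero qopp qadd.
Proof. by move=> x; rewrite /qadd /= !addNr. Qed.

HB.instance Definition _ := GRing.isZmodule.Build H qaddA qaddC qadd0 qaddN.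

(* Bilinear extension of i^2 = -1, j^2 = k^2 = 1, ij = k = -ji,
   jk = -i = -kj, ki = j = -ik. *)
Definition qmul x y := SplitQuat
  (qre x * qre y - qi x * qi y + qj x * qj y + qk x * qk y)
  (qre x * qi y + qi x * qre y - qj x * qk y + qk x * qj y)
  (qre x * qj y + qj x * qre y - qi x * qk y + qk x * qi y)
  (qre x * qk y + qk x * qre y + qi x * qj y - qj x * qi y).
Definition qone : H := SplitQuat 1 0 0 0.

Lemma qmulA : associative qmul.
Proof. by move=> x y z; congr SplitQuat => /=; ring. Qed.
Lemma qmul1l : left_id qone qmul.
Proof. by case=> *; congr SplitQuat => /=; ring. Qed.
Lemma qmul1r : right_id qone qmul.
Proof. by case=> *; congr SplitQuat => /=; ring. Qed.
Lemma qmulDl : left_distributive qmul +%R.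
Proof. by move=> x y z; congr SplitQuat => /=; ring. Qed.
Lemma qmulDr : right_distributive qmul +%R.
Proof. by move=> x y z; congr SplitQuat => /=; ring. Qed.
Lemma qone_neq0 : qone != 0.
Proof. by apply/eqP => -[] /eqP; rewrite oner_eq0. Qed.

HB.instance Definition _ := GRing.Zmodule_isNzRing.Build H
  qmulA qmul1l qmul1r qmulDl qmulDr qone_neq0.

Definition qscale (r : R) x :=
  SplitQuat (r * qre x) (r * qi x) (r * qj x) (r * qk x).

Lemma qscaleA r s x : qscale r (qscale s x) = qscale (r * s) x.
Proof. by congr SplitQuat => /=; rewrite mulrA. Qed.
Lemma qscale1 : left_id 1 qscale.
Proof. by case=> *; rewrite /qscale /= !mul1r. Qed.
Lemma qscaleDr : right_distributive qscale +%R.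
Proof. by move=> r x y; congr SplitQuat => /=; rewrite mulrDr. Qed.
Lemma qscaleDl x : {morph qscale^~ x : r s / r + s}.
Proof. by move=> r s; congr SplitQuat => /=; rewrite mulrDl. Qed.

HB.instance Definition _ := GRing.Zmodule_isLmodule.Build R H
  qscaleA qscale1 qscaleDr qscaleDl.

Lemma qscaleAl (r : R) x y : r *: (x * y) = (r *: x) * y.
Proof. by congr SplitQuat => /=; ring. Qed.
Lemma qscaleAr (r : R) x y : r *: (x * y) = x * (r *: y).
Proof. by congr SplitQuat => /=; ring. Qed.

HB.instance Definition _ := GRing.Lmodule_isLalgebra.Build R H qscaleAl.
HB.instance Definition _ := GRing.Lalgebra_isAlgebra.Build R H qscaleAr.

Definition Hi : H := SplitQuat 0 1 0 0.
Definition Hj : H := SplitQuat 0 0 1 0.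
Definition Hk : H := SplitQuat 0 0 0 1.

Definition qconj x := SplitQuat (qre x) (- qi x) (- qj x) (- qk x).
Definition qP x y : R :=
  qre x * qre y + qi x * qi y - qj x * qj y - qk x * qk y.
Definition qI x : R := qP x x.

Lemma qconj_mull x : qconj x * x = (qI x)%:A.
Proof. by congr SplitQuat; rewrite /qI /qP /=; ring. Qed.
Lemma qconj_mulr x : x * qconj x = (qI x)%:A.
Proof. by congr SplitQuat; rewrite /qI /qP /=; ring. Qed.
Lemma qI_mul x y : qI (x * y) = qI x * qI y.
Proof. by rewrite /qI /qP /=; ring. Qed.

Definition qunit : pred H := fun x => qI x != 0.
(* Outside the units, MathComp's convention is x^-1 = x. *)
Definition qinv x := if qI x != 0 then (qI x)^-1 *: qconj x else x.

Lemma qmulVr : {in qunit, left_inverse 1 qinv *%R}.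
Proof.
move=> x; rewrite unfold_in /qinv => Ix; rewrite Ix.
by rewrite -qscaleAl qconj_mull scalerA mulVf // scale1r.
Qed.
Lemma qdivrr : {in qunit, right_inverse 1 qinv *%R}.
Proof.
move=> x; rewrite unfold_in /qinv => Ix; rewrite Ix.
by rewrite -qscaleAr qconj_mulr scalerA mulVf // scale1r.
Qed.
Lemma qunitP x y : y * x = 1 /\ x * y = 1 -> qunit x.
Proof.
move=> [_ /(congr1 qI)]; rewrite qI_mul.
have ->: qI 1 = 1 by rewrite /qI /qP /=; ring.
by move=> e; apply/eqP => Ix; move/eqP: e; rewrite Ix mul0r eq_sym oner_eq0.
Qed.
Lemma qinv_out : {in [predC qunit], qinv =1 id}.
Proof. by move=> x; rewrite /qinv inE unfold_in => /negPf ->. Qed.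

HB.instance Definition _ := GRing.NzRing_hasMulInverse.Build H
  qmulVr qdivrr qunitP qinv_out.

Lemma splitquatE x :
  x = (qre x)%:A + qi x *: Hi + qj x *: Hj + qk x *: Hk.
Proof. by case: x => *; congr SplitQuat => /=; ring. Qed.

Lemma HiHi : Hi * Hi = -1. Proof. by congr SplitQuat => /=; ring. Qed.
Lemma HjHj : Hj * Hj = 1. Proof. by congr SplitQuat => /=; ring. Qed.
Lemma HkHk : Hk * Hk = 1. Proof. by congr SplitQuat => /=; ring. Qed.
Lemma HiHj : Hi * Hj = Hk. Proof. by congr SplitQuat => /=; ring. Qed.
Lemma HjHi : Hj * Hi = - Hk. Proof. by congr SplitQuat => /=; ring. Qed.
Lemma HjHk : Hj * Hk = - Hi. Proof. by congr SplitQuat => /=; ring. Qed.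
Lemma HkHj : Hk * Hj = Hi. Proof. by congr SplitQuat => /=; ring. Qed.
Lemma HkHi : Hk * Hi = Hj. Proof. by congr SplitQuat => /=; ring. Qed.
Lemma HiHk : Hi * Hk = - Hj. Proof. by congr SplitQuat => /=; ring. Qed.

Lemma qunitE x : (x \is a GRing.unit) = (qI x != 0).
Proof. by []. Qed.
Lemma qinvE x : x \is a GRing.unit -> x^-1 = (qI x)^-1 *: qconj x.
Proof. by rewrite qunitE => Ix; rewrite /GRing.inv /= /qinv Ix. Qed.

End SplitQuatAlgebra.

Arguments Hi {R}.
Arguments Hj {R}.
Arguments Hk {R}.

(* Main.v *)
Require Import Defs.
From mathcomp Require Import all_boot all_order all_algebra.
From mathcomp Require Import reals.
From mathcomp Require Import ring.

Import GRing.Theory.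
Local Open Scope ring_scope.

(** Every split quaternion [x] is a root of its real characteristic polynomial
    [X^2 - t X + n], with trace [t = 2 Re x] and norm [n = I_x]
    ([sqr_eq_trace_norm]).  Substituting for [x^2] makes the quadratic equation
    linear in [x] as soon as [t] and [n] are regarded as known:
    [(t a + b) x = n a - c].  The left coefficient is invertible whatever [t]
    is, since [I_a = 0] and [P_ab = 0] give [I_(ta+b) = I_b <> 0].  It remains
    to find which [t] and [n] are consistent, that is, which are the trace and
    the norm of [(t a + b)^-1 (n a - c)].  Computing this trace and this norm
    ([qre_divl], [qI_divl]) and using [I_a = P_ab = 0] once more turns the two
    consistency conditions into
    [n (I_b + 2 P_ac) = I_c] and [t (I_b + 2 P_ac) = - 2 P_bc].
    They are linear and decoupled, with the single solution [n = N], [t = T];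
    this proves uniqueness and existence at once. *)

Section TraceNorm.
Variable R : realType.
Implicit Types (r s t n : R) (a b c u v x : splitquat R).

(** Cayley-Hamilton: [x^2 = x (2 Re x - conj x)], where [x conj x = I_x]. *)
Lemma sqr_eq_trace_norm x : x ^+ 2 = (2 * qre x) *: x - (qI x)%:A.
Proof. by rewrite expr2; congr SplitQuat; rewrite /qI /qP /=; ring. Qed.

Lemma qI_pencil r s x y :
  qI (r *: x + s *: y) = r ^+ 2 * qI x + 2 * r * s * qP x y + s ^+ 2 * qI y.
Proof. by rewrite /qI /qP /=; ring. Qed.

Lemma qP_pencil r s a b c :
  qP (r *: a + b) (s *: a - c) =
  r * s * qI a - r * qP a c + s * qP a b - qP b c.
Proof. by rewrite /qI /qP /=; ring. Qed.

(** [u^-1 v = conj u v / I_u], and [P] is the polarisation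
    [P_uv = Re (conj u v)]. *)
Lemma qre_divl u v : u \is a GRing.unit -> qre (u^-1 * v) = qP u v / qI u.
Proof. by move=> Uu; rewrite qinvE // /qP /=; ring. Qed.

(** Multiplicativity of the norm, applied to [u (u^-1 v) = v]. *)
Lemma qI_divl u v : u \is a GRing.unit -> qI (u^-1 * v) = qI v / qI u.
Proof.
move=> Uu; have Iu : qI u != 0 by rewrite -qunitE.
by rewrite -[v in RHS](mulVKr Uu) [in RHS]qI_mul mulrAC divff ?mul1r.
Qed.

Lemma quadratic_linearised a b c x :
  a * x ^+ 2 + b * x + c =
  ((2 * qre x) *: a + b) * x - (qI x *: a - c).
Proof.
rewrite sqr_eq_trace_norm; set t := 2 * _; set n := qI x.
rewrite mulrBr -!scalerAr mulr1 mulrDl -scalerAl.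
by rewrite opprB [c - _]addrC addrA; congr (_ + _); rewrite addrAC.
Qed.

Section IsotropicLeadingCoefficient.
Variables a b c : splitquat R.
Hypotheses (Ia : qI a = 0) (Pab : qP a b = 0) (Ib : qI b != 0).

Lemma qI_linear_coef t : qI (t *: a + b) = qI b.
Proof. by rewrite -[b in LHS]scale1r qI_pencil Ia Pab; ring. Qed.

Lemma linear_coef_unit t : t *: a + b \is a GRing.unit.
Proof. by rewrite qunitE qI_linear_coef. Qed.

Lemma qI_constant_term n : qI (n *: a - c) = qI c - 2 * n * qP a c.
Proof. by rewrite -scaleN1r qI_pencil Ia; ring. Qed.

Lemma qP_linear_coef_constant_term t n :
  qP (t *: a + b) (n *: a - c) = - t * qP a c - qP b c.
Proof. by rewrite qP_pencil Ia Pab; ring. Qed.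

Let linear_solution t n := (t *: a + b)^-1 * (n *: a - c).

(** Fixed-point form of the equation: a root is the solution of the linear
    equation whose parameters are the trace and the norm of that same root. *)
Lemma root_linear_solution x :
  a * x ^+ 2 + b * x + c = 0 <-> x = linear_solution (2 * qre x) (qI x).
Proof.
have U := linear_coef_unit (2 * qre x).
rewrite quadratic_linearised /linear_solution; split.
  by move=> /subr0_eq <-; rewrite mulKr.
by move=> ex; rewrite [X in _ * X - _]ex mulVKr // subrr.
Qed.

(** Both conditions come from clearing the denominator
    [I_(ta+b) = I_b]; the one on the norm does not involve [t], because [t]
    enters [linear_solution] only through a factor of constant norm. *)
Lemma linear_solution_norm t n :
  qI (linear_solution t n) = n <-> n * (qI b + 2 * qP a c) = qI c.
Proof.
rewrite qI_divl ?linear_coef_unit // qI_linear_coef qI_constant_term.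
split=> [/(canRL (divfK Ib)) e | <-]; last by field.
by rewrite mulrDr -e; ring.
Qed.

Lemma linear_solution_trace t n :
  2 * qre (linear_solution t n) = t <->
  t * (qI b + 2 * qP a c) = - 2 * qP b c.
Proof.
rewrite qre_divl ?linear_coef_unit // qI_linear_coef.
rewrite qP_linear_coef_constant_term mulrA.
split=> [/(canRL (divfK Ib)) e | e]; first by rewrite mulrDr -e; ring.
have -> : 2 * (- t * qP a c - qP b c) = t * qI b.
  by rewrite mulrBr -[2 * qP b c]opprK -mulNr -e; ring.
by rewrite mulfK.
Qed.

Lemma isotropic_quadratic_root x : qI b + 2 * qP a c != 0 ->
  a * x ^+ 2 + b * x + c = 0 <->
  x = linear_solution (- 2 * qP b c / (qI b + 2 * qP a c))
                      (qI c / (qI b + 2 * qP a c)).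
Proof.
move=> D0; rewrite root_linear_solution; split=> ex.
  have /esym/linear_solution_norm en := congr1 (@qI R) ex.
  have /esym/linear_solution_trace et := congr1 (fun y => 2 * qre y) ex.
  by rewrite -en -et !mulfK.
by rewrite ex; congr (linear_solution _ _); apply/esym;
   [apply/linear_solution_trace | apply/linear_solution_norm]; rewrite divfK.
Qed.

End IsotropicLeadingCoefficient.
End TraceNorm.

Theorem theorem5p5 (R : realType) (a2 a3 b1 b2 b3 : R) (a b c : splitquat R)
    (def_a : a = 1 + a2 *: Hj + a3 *: Hk)
    (a23 : a2 ^+ 2 + a3 ^+ 2 = 1)
    (def_b : b = b1 *: Hi + b2 *: Hj + b3 *: Hk)
    (b_neq0 : b != 0)
    (Pab : qP a b = 0)
    (Ib : qI b != 0)
    (Ibc : qI b + 2 * qP a c != 0) :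
  let N : R := qI c / (qI b + 2 * qP a c) in
  let T : R := - 2 * qP b c / (qI b + 2 * qP a c) in
  (exists x : splitquat R, a * x ^+ 2 + b * x + c = 0) /\
  T *: a + b \is a GRing.unit /\
  (forall x : splitquat R,
     a * x ^+ 2 + b * x + c = 0 <-> x = (T *: a + b)^-1 * (N *: a - c)).
Proof.
move=> N T.
have Ia : qI a = 0.
  have -> : qI a = 1 - (a2 ^+ 2 + a3 ^+ 2) by rewrite def_a /qI /qP /=; ring.
  by rewrite a23 subrr.
have rootP x := isotropic_quadratic_root R a b c Ia Pab Ib x Ibc.
split; first by exists ((T *: a + b)^-1 * (N *: a - c)); apply/rootP.
by split; first exact: linear_coef_unit.
Qed.
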